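(* Let $n>0$ be a real number. The spherical (Archimedean) spiral curves $\varphi=n\lambda$ are the only spherical curves (up to rotations around the $z$-axis) with spherical angular momentum $\mathcal K(\varphi)=-\cos^2\varphi/\sqrt{n^2+\cos^2\varphi}$. That is, let $\xi=(\cos\varphi\cos\lambda,\cos\varphi\sin\lambda,\sin\varphi):I\to\mathbb{S}^2$ be a unit-speed $C^2$ curve on an open interval with $C^2$ coordinate functions $|\varphi|<\pi/2$, $\lambda$, and $\dot\varphi>0$. Then $\mathcal K=-\cos^2\varphi/\sqrt{n^2+\cos^2\varphi}$ along $\xi$ if and only if there is a constant $\lambda_0\in\mathbb{R}$ with $\varphi=n(\lambda-\lambda_0)$ along $\xi$ (i.e. after a rotation around the $z$-axis, $\xi$ is an arc of the spiral $\varphi=n\lambda$).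
   Context: $\mathbb{S}^2\subset\mathbb{R}^3$ is the unit sphere centred at the origin, with geographical coordinates latitude $\varphi$ and longitude $\lambda$; a dot denotes derivative with respect to arc length. The spherical angular momentum of a unit-speed curve $\xi=(x,y,z)$ in $\mathbb{S}^2$ (with respect to the $z$-axis) is $\mathcal K=-\det(\xi,\dot\xi,(0,0,1))=\dot x y-x\dot y=-\dot\lambda\cos^2\varphi$. The spherical Archimedean spirals (clelias) are the curves described in geographical coordinates by $\varphi=n\lambda$, $n>0$. *)

(* Defs.v *)
From Stdlib Require Import Reals.
From Coquelicot Require Import Coquelicot.
Open Scope R_scope.

Record vec3 : Type := Vec3 { cx : R; cy : R; cz : R }.

Definition dot3 (u v : vec3) : R := cx u * cx v + cy u * cy v + cz u * cz v.

Definition norm3 (u : vec3) : R := sqrt (dot3 u u).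

Definition det3 (u v w : vec3) : R :=
  cx u * (cy v * cz w - cz v * cy w)
  - cy u * (cx v * cz w - cz v * cx w)
  + cz u * (cx v * cy w - cy v * cx w).

Definition e_z : vec3 := Vec3 0 0 1.

(* An open interval is given by extended-real endpoints, so that half-lines
   and the whole line are included. *)
Definition in_open_itv (a b : Rbar) (s : R) : Prop :=
  Rbar_lt a s /\ Rbar_lt s b.

(* [ex_derive_n f 2 s] alone does not give differentiability of [f], since
   [Derive] is total; hence the quantification over all orders up to 2. *)
Definition C2_on (a b : Rbar) (f : R -> R) : Prop :=
  forall (k : nat) (s : R), (k <= 2)%nat -> in_open_itv a b s ->
    ex_derive_n f k s /\ continuous (Derive_n f k) s.

Definition C2_curve_on (a b : Rbar) (xi : R -> vec3) : Prop :=
  C2_on a b (fun s => cx (xi s)) /\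
  C2_on a b (fun s => cy (xi s)) /\
  C2_on a b (fun s => cz (xi s)).

Definition velocity (xi : R -> vec3) (s : R) : vec3 :=
  Vec3 (Derive (fun t => cx (xi t)) s)
       (Derive (fun t => cy (xi t)) s)
       (Derive (fun t => cz (xi t)) s).

Definition unit_speed_on (a b : Rbar) (xi : R -> vec3) : Prop :=
  forall s : R, in_open_itv a b s -> norm3 (velocity xi s) = 1.

(* Point of the unit sphere with latitude [phi] and longitude [lambda]. *)
Definition geographic (phi lambda : R) : vec3 :=
  Vec3 (cos phi * cos lambda) (cos phi * sin lambda) (sin phi).

Definition angular_momentum (xi : R -> vec3) (s : R) : R :=
  - det3 (xi s) (velocity xi s) e_z.

(* Main.v *)
Require Import Defs.
From Stdlib Require Import Reals Lra ssreflect.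
From Coquelicot Require Import Coquelicot.
Open Scope R_scope.

(** Along the curve, unit speed reads [phi'^2 + cos(phi)^2 lambda'^2 = 1] and
    the angular momentum is [- cos(phi)^2 lambda']. Hence prescribing it as in
    the theorem means [lambda' = 1 / sqrt (n^2 + cos(phi)^2)], and, as [phi' > 0],
    unit speed makes this equivalent to [phi' = n lambda']. *)

Lemma locally_in_open_itv (a b : Rbar) (s : R) :
  in_open_itv a b s -> locally s (in_open_itv a b).
Proof.
intros [Has Hsb].
exact (filter_and _ _ (open_Rbar_gt' s a Has) (open_Rbar_lt' s b Hsb)).
Qed.

Lemma open_itv_inhabited (a b : Rbar) :
  Rbar_lt a b -> exists s, in_open_itv a b s.
Proof.
unfold in_open_itv.
destruct a as [a| |]; destruct b as [b| |]; simpl; try easy; intros Hab.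
- exists ((a + b) / 2); lra.
- exists (a + 1); lra.
- exists (b - 1); lra.
- now exists 0.
Qed.

Lemma open_itv_convex (a b : Rbar) (s t u : R) :
  in_open_itv a b s -> in_open_itv a b t -> s <= u <= t -> in_open_itv a b u.
Proof.
intros [Has _] [_ Htb] [Hsu Hut]; split.
- exact (Rbar_lt_le_trans _ (Finite s) (Finite u) Has Hsu).
- exact (Rbar_le_lt_trans (Finite u) (Finite t) _ Hut Htb).
Qed.

(** The segment joining [s] and [t] stays in the interval by convexity, so the vanishing derivative
    on it forces equal end values; finite and infinite [a], [b] are treated alike. *)
Lemma constant_on_open_itv (a b : Rbar) (f : R -> R) (s t : R) :
  (forall u, in_open_itv a b u -> is_derive f u 0) ->
  in_open_itv a b s -> in_open_itv a b t -> f s = f t.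
Proof.
intros Hf Hs Ht.
destruct (Rtotal_order s t) as [Hst|[->|Hts]]; [|reflexivity|symmetry].
- apply (eq_is_derive f); trivial.
  intros u Hu; exact (Hf u (open_itv_convex a b s t u Hs Ht Hu)).
- apply (eq_is_derive f); trivial.
  intros u Hu; exact (Hf u (open_itv_convex a b t s u Ht Hs Hu)).
Qed.

Lemma C2_on_derivable (a b : Rbar) (f : R -> R) (s : R) :
  C2_on a b f -> in_open_itv a b s -> is_derive f s (Derive f s).
Proof.
intros Hf Hs; apply Derive_correct.
exact (proj1 (Hf 1%nat s (le_S _ _ (le_n 1)) Hs)).
Qed.

Lemma velocity_geographic (a b : Rbar) (xi : R -> vec3) (phi lambda : R -> R)
  (s dphi dlambda : R) :
  (forall t, in_open_itv a b t -> xi t = geographic (phi t) (lambda t)) ->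
  in_open_itv a b s -> is_derive phi s dphi -> is_derive lambda s dlambda ->
  velocity xi s =
  Vec3 (- sin (phi s) * dphi * cos (lambda s)
          - cos (phi s) * sin (lambda s) * dlambda)
       (- sin (phi s) * dphi * sin (lambda s)
          + cos (phi s) * cos (lambda s) * dlambda)
       (cos (phi s) * dphi).
Proof.
intros Hxi Hs Hphi Hlambda.
assert (Dphi := is_derive_unique _ _ _ Hphi).
assert (Dlambda := is_derive_unique _ _ _ Hlambda).
assert (Ephi : ex_derive phi s) by (now exists dphi).
assert (Elambda : ex_derive lambda s) by (now exists dlambda).
(* The parametrization of [xi] is known on the interval only. As this is a neighbourhood of [s], it
   still determines the derivatives at [s]. *)
assert (Hloc := locally_in_open_itv a b s Hs).
unfold velocity; f_equal; apply is_derive_unique.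
- apply is_derive_ext_loc with (fun t => cos (phi t) * cos (lambda t)).
  + apply: filter_imp Hloc => t Ht; now rewrite (Hxi t Ht).
  + auto_derive; [now repeat split|].
    change (Derive (fun t => phi t) s) with (Derive phi s).
    change (Derive (fun t => lambda t) s) with (Derive lambda s).
    rewrite Dphi Dlambda; ring.
- apply is_derive_ext_loc with (fun t => cos (phi t) * sin (lambda t)).
  + apply: filter_imp Hloc => t Ht; now rewrite (Hxi t Ht).
  + auto_derive; [now repeat split|].
    change (Derive (fun t => phi t) s) with (Derive phi s).
    change (Derive (fun t => lambda t) s) with (Derive lambda s).
    rewrite Dphi Dlambda; ring.
- apply is_derive_ext_loc with (fun t => sin (phi t)).
  + apply: filter_imp Hloc => t Ht; now rewrite (Hxi t Ht).
  + auto_derive; [now repeat split|].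
    change (Derive (fun t => phi t) s) with (Derive phi s).
    rewrite Dphi; ring.
Qed.

(** Oriented as a rewrite rule for [ring], which then eliminates squared sines in favour of
    cosines. *)
Lemma sin_sqr (x : R) : sin x * sin x = 1 - cos x * cos x.
Proof. generalize (sin2_cos2 x); unfold Rsqr; lra. Qed.

(** The determinant reduces to x y' - y x'. There the [dphi] terms cancel, and the [dlambda] terms
    carry the factor cos^2 + sin^2 of the longitude. *)
Lemma angular_momentum_geographic (a b : Rbar) (xi : R -> vec3)
  (phi lambda : R -> R) (s dphi dlambda : R) :
  (forall t, in_open_itv a b t -> xi t = geographic (phi t) (lambda t)) ->
  in_open_itv a b s -> is_derive phi s dphi -> is_derive lambda s dlambda ->
  angular_momentum xi s = - cos (phi s) ^ 2 * dlambda.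
Proof.
intros Hxi Hs Hphi Hlambda.
unfold angular_momentum.
rewrite (velocity_geographic _ _ _ _ _ _ _ _ Hxi Hs Hphi Hlambda) (Hxi s Hs).
unfold det3, e_z, geographic; simpl.
ring [(sin_sqr (lambda s))].
Qed.

(** This is the first fundamental form of the sphere: meridians and parallels are orthogonal, so the
    mixed term in [dphi * dlambda] cancels. *)
Lemma norm3_velocity_geographic (a b : Rbar) (xi : R -> vec3)
  (phi lambda : R -> R) (s dphi dlambda : R) :
  (forall t, in_open_itv a b t -> xi t = geographic (phi t) (lambda t)) ->
  in_open_itv a b s -> is_derive phi s dphi -> is_derive lambda s dlambda ->
  norm3 (velocity xi s) = sqrt (dphi ^ 2 + cos (phi s) ^ 2 * dlambda ^ 2).
Proof.
intros Hxi Hs Hphi Hlambda.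
rewrite (velocity_geographic _ _ _ _ _ _ _ _ Hxi Hs Hphi Hlambda).
unfold norm3, dot3; simpl; f_equal.
ring [(sin_sqr (lambda s)) (sin_sqr (phi s))].
Qed.

(** The pointwise algebra, with [c], [p], [l] standing for cos(phi), phi', lambda'. Both sides
    amount to [l * r = 1], where [r] is the square root; positivity settles the signs lost by
    squaring. *)
Lemma spiral_slope_iff (n c p l : R) :
  0 < n -> 0 < c -> 0 < p -> p ^ 2 + c ^ 2 * l ^ 2 = 1 ->
  - c ^ 2 * l = - c ^ 2 / sqrt (n ^ 2 + c ^ 2) <-> p = n * l.
Proof.
intros Hn Hc Hp Hunit.
assert (Hq : 0 < n ^ 2 + c ^ 2) by nra.
assert (Hr := sqrt_lt_R0 _ Hq).
assert (Hr2 := pow2_sqrt _ (Rlt_le _ _ Hq)).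
set (r := sqrt (n ^ 2 + c ^ 2)) in *.
split; intros H.
- assert (Hl : l * r = 1).
  { apply Rmult_eq_reg_l with (- c ^ 2); [|nra].
    transitivity (- c ^ 2 * l * r); [ring|rewrite H; field; lra]. }
  assert (Hl0 : 0 < l) by nra.
  assert (Hl2 : l ^ 2 * (n ^ 2 + c ^ 2) = 1).
  { rewrite -Hr2; replace (l ^ 2 * r ^ 2) with ((l * r) ^ 2) by ring.
    rewrite Hl; ring. }
  (* Both members are positive, so squares suffice: p^2 = 1 - c^2 l^2 by unit speed, and this is n^2
     l^2 by [Hl2]. *)
  apply Rsqr_inj; [lra|nra|unfold Rsqr; nra].
- assert (Hl0 : 0 < l) by nra.
  assert (Hl : l * r = 1).
  (* The square of the claim is the unit speed relation with [p] replaced by [n * l]. *)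
  { apply Rsqr_inj; [nra|lra|].
    transitivity (l ^ 2 * r ^ 2); [unfold Rsqr; ring|].
    rewrite Hr2; unfold Rsqr; rewrite H in Hunit; lra. }
  transitivity (- c ^ 2 * (l * r) / r); [field; lra|rewrite Hl; field; lra].
Qed.

Theorem corollary6p2 (n : R) (hn : 0 < n)
  (a b : Rbar) (hab : Rbar_lt a b)
  (xi : R -> vec3) (phi lambda : R -> R)
  (hxi : forall s : R, in_open_itv a b s -> xi s = geographic (phi s) (lambda s))
  (hxi_C2 : C2_curve_on a b xi)
  (hxi_unit : unit_speed_on a b xi)
  (hphi_C2 : C2_on a b phi)
  (hlambda_C2 : C2_on a b lambda)
  (hphi_lt : forall s : R, in_open_itv a b s -> Rabs (phi s) < PI / 2)
  (hphi_incr : forall s : R, in_open_itv a b s -> 0 < Derive phi s) :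
  (forall s : R, in_open_itv a b s ->
     angular_momentum xi s
     = - cos (phi s) ^ 2 / sqrt (n ^ 2 + cos (phi s) ^ 2))
  <->
  (exists lambda0 : R, forall s : R, in_open_itv a b s ->
     phi s = n * (lambda s - lambda0)).
Proof.
assert (Dphi := fun s => C2_on_derivable a b phi s hphi_C2).
assert (Dlambda := fun s => C2_on_derivable a b lambda s hlambda_C2).
assert (Hslope : forall s, in_open_itv a b s ->
  angular_momentum xi s = - cos (phi s) ^ 2 / sqrt (n ^ 2 + cos (phi s) ^ 2)
  <-> Derive phi s = n * Derive lambda s).
{ intros s Hs.
  rewrite (angular_momentum_geographic _ _ _ _ _ _ _ _ hxi Hs
             (Dphi s Hs) (Dlambda s Hs)).
  apply spiral_slope_iff; auto.
  - assert (Hphi := Rabs_def2 _ _ (hphi_lt s Hs)); apply cos_gt_0; lra.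
  - assert (Hunit := hxi_unit s Hs).
    rewrite (norm3_velocity_geographic _ _ _ _ _ _ _ _ hxi Hs
               (Dphi s Hs) (Dlambda s Hs)) in Hunit.
    (* Writing 1 as [sqrt 1] lets injectivity of the root give the polynomial form of unit speed. *)
    rewrite -sqrt_1 in Hunit; apply sqrt_inj in Hunit; nra. }
split.
- intros HK.
  destruct (open_itv_inhabited a b hab) as [s0 Hs0].
  (* The spiral equation at the base point [s0] forces this value. *)
  exists (lambda s0 - phi s0 / n); intros s Hs.
  assert (Hconst : phi s - n * lambda s = phi s0 - n * lambda s0).
  { apply (constant_on_open_itv a b (fun t => phi t - n * lambda t)); trivial.
    intros u Hu.
    replace 0 with (Derive phi u - n * Derive lambda u)
      by (rewrite (proj1 (Hslope u Hu) (HK u Hu)); ring).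
    apply: is_derive_minus (Dphi u Hu) _.
    exact (is_derive_scal _ _ n _ (Dlambda u Hu)). }
  replace (phi s) with (phi s0 - n * lambda s0 + n * lambda s) by lra.
  field; lra.
- intros [lambda0 Hspiral] s Hs.
  apply (Hslope s Hs).
  (* The spiral equation holds near [s], so it may be differentiated there. *)
  rewrite (Derive_ext_loc phi (fun t => n * (lambda t - lambda0))).
  + apply is_derive_unique; auto_derive; [now exists (Derive lambda s); auto|].
    change (Derive (fun t => lambda t) s) with (Derive lambda s); ring.
  + exact (filter_imp _ _ Hspiral (locally_in_open_itv a b s Hs)).
Qed.
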